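(* Let $1\le \ell\le n$, let $I$ and $J$ be the $n\times n$ identity and all-ones matrices, and let $s,t$ be scalars (or indeterminates). Then $$(sI+tJ)^{\vee\ell}=\sum_{k}\sum_{j=k}^{\ell}\binom{\ell-k}{\ell-j}\,j!\,s^{\ell-j}t^{j}\,\mathrm{JS}^{n\ell}_{k}=\sum_{k} h_{\ell-k,k}(s,t)\,\mathrm{JS}^{n\ell}_{k},$$ where $k$ ranges over $0\le k\le \min(\ell,n-\ell)$.
   Context: For an $n\times n$ matrix $Y$, $Y^{\vee\ell}$ is the $\binom n\ell\times\binom n\ell$ matrix indexed by $\ell$-subsets of $[n]=\{1,\dots,n\}$ whose $(\mathrm{S},\mathrm{T})$ entry is the permanent of the submatrix of $Y$ with rows $\mathrm{S}$ and columns $\mathrm{T}$. The Johnson distance between $\ell$-subsets is $\mathrm{dist}(\mathrm{S},\mathrm{T})=|\mathrm{S}\setminus\mathrm{T}|$, and $\mathrm{JS}^{n\ell}_k$ is the $\binom n\ell\times\binom n\ell$ $0$-$1$ matrix indexed by $\ell$-subsets with $(\mathrm{S},\mathrm{T})$ entry $1$ iff $\mathrm{dist}(\mathrm{S},\mathrm{T})=k$. The exponential moment polynomials are $h_{a,b}(x,t)=\int_0^\infty (x+ty)^a(ty)^b e^{-y}\,dy=\sum_{j=0}^a\binom aj (b+j)!\,x^{a-j}t^{b+j}$. *)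

(* Defs.v *)
From mathcomp Require Import all_boot all_order all_fingroup all_algebra.
From mathcomp Require Import all_classical all_reals all_analysis.
Set Implicit Arguments.
Unset Strict Implicit.
Unset Printing Implicit Defensive.
Import Order.TTheory GRing.Theory Num.Theory.
Local Open Scope ring_scope.

Definition lsubset (n l : nat) := {S : {set 'I_n} | #|S| == l}.

(* Binomial-sized matrices are indexed by 'I_#|{: lsubset n l}| through
   enum_val; #|{: lsubset n l}| is provably 'C(n, l). *)
Definition lsub (n l : nat) (i : 'I_#|{: lsubset n l}|) : lsubset n l :=
  enum_val i.

(* The i-th element of S in increasing order, used to view the submatrix on
   rows S and columns T as an l x l matrix. *)
Definition lsub_elt (n l : nat) (S : lsubset n l) (i : 'I_l) : 'I_n :=
  enum_val (cast_ord (esym (eqP (valP S))) i).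

Definition permanent (R : comNzRingType) (m : nat) (A : 'M[R]_m) : R :=
  \sum_(p : 'S_m) \prod_(i < m) A i (p i).

Definition perm_compound (R : comNzRingType) (n l : nat) (Y : 'M[R]_n) :
    'M[R]_#|{: lsubset n l}| :=
  \matrix_(i, j) permanent (mxsub (lsub_elt (lsub i)) (lsub_elt (lsub j)) Y).

Definition johnson_dist (n l : nat) (S T : lsubset n l) : nat :=
  #|val S :\: val T|.

Definition JS (R : comNzRingType) (n l k : nat) : 'M[R]_#|{: lsubset n l}| :=
  \matrix_(i, j) (johnson_dist (lsub i) (lsub j) == k)%:R.

(* Exponential moment polynomial in expanded form, which makes sense over any
   commutative ring (in particular for indeterminates x and t). *)
Definition exp_moment (R : comNzRingType) (a b : nat) (x t : R) : R :=
  \sum_(j < a.+1) ('C(a, j) * (b + j)`!)%:R * x ^+ (a - j) * t ^+ (b + j).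

(* Exponential moment polynomial as the integral defining it, for real x, t.
   Rintegral is 0 when the integral diverges, but this one always converges. *)
Definition exp_moment_int (R : realType) (a b : nat) (x t : R) : R :=
  Rintegral (@lebesgue_measure R) `[0, +oo[%classic
    (fun y : R => (x + t * y) ^+ a * (t * y) ^+ b * expR (- y)).

(* Main.v *)
(* Expand each product [\prod_i (s * M_i,p(i) + t)] of the permanent over the set
   U of indices where the [s]-term is chosen, M being the 0-1 matrix of the
   partial matching of S with T given by S :&: T.  A set U contributes only if
   it lies in the l - k matched rows, and then exactly (l - #|U|)! permutations
   extend the matching restricted to U.  The integral form reduces to
   \int_0^oo y^n e^-y = n!. *)
Require Import Defs.
From mathcomp Require Import all_boot all_order all_fingroup all_algebra.
From mathcomp Require Import all_classical all_reals all_analysis.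
From mathcomp Require Import measurable_realfun ring.
Set Implicit Arguments.
Unset Strict Implicit.
Import Order.TTheory GRing.Theory Num.Theory.
Import numFieldNormedType.Exports.
Local Open Scope ring_scope.

(** * Permutations with prescribed values on a subset *)

(* Transpositions enlarge the set of agreement with f one point at a time. *)
Lemma perm_extend (T : finType) (D : {set T}) (f : T -> T) :
  {in D &, injective f} -> exists q : {perm T}, {in D, q =1 f}.
Proof.
move=> f_inj.
suff H (r : seq T) : uniq r -> {in r &, injective f} ->
    exists q : {perm T}, {in r, q =1 f}.
  have [|q qE] := H (enum D) (enum_uniq _).
    by move=> x y; rewrite !mem_enum; apply: f_inj.
  by exists q => x xD; apply: qE; rewrite mem_enum.
elim: r => [|x r IH] /=; first by exists 1%g.
case/andP=> xr r_uniq fr_inj.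
have [|q qE] := IH r_uniq.
  by move=> y z yr zr; apply: fr_inj; rewrite inE ?yr ?zr orbT.
exists (q * tperm (q x) (f x))%g => y; rewrite inE permM.
have [->|yx /= yr] := eqVneq y x; first by rewrite tpermL.
(* [q y] differs from [q x] because [q] is injective, and from [f x] because [f] is injective on the
   list, so the swap leaves it alone. *)
rewrite tpermD ?(inj_eq perm_inj) 1?eq_sym ?qE //.
apply: contraNneq yx => /fr_inj fxy.
by rewrite -fxy ?inE ?eqxx ?yr ?orbT.
Qed.

(** Fix one extension [q] of [f]. Multiplying by [q] on the right carries the permutations supported
    off [D] bijectively onto those that agree with [f] on [D]. *)
Lemma card_perm_extend (T : finType) (D : {set T}) (f : T -> T) :
  {in D &, injective f} ->
  #|[set p : {perm T} | [forall x in D, p x == f x]]| = (#|T| - #|D|)`!.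
Proof.
case/perm_extend => q qE.
have -> : (#|T| - #|D|)%N = #|~: D| by rewrite [RHS]cardsCs finset.setCK.
rewrite -card_perm -[RHS](card_imset _ (mulIg q)).
apply: eq_card => p; rewrite inE; apply/forall_inP/imsetP => [pE|[r rD ->] x xD].
  exists (p * q^-1)%g; last by rewrite mulgKV.
  apply/fintype.subsetP => x; rewrite !inE; apply: contraNN => xD.
  by rewrite permM (eqP (pE x xD)) -qE // permK.
by rewrite permM (out_perm rD) ?qE // inE xD.
Qed.

Lemma sum_subset_card (R : pzSemiRingType) (T : finType) (D : {set T})
    (g : nat -> R) :
  \sum_(U : {set T} | U \subset D) g #|U| =
  \sum_(u < #|D|.+1) 'C(#|D|, u)%:R * g u.
Proof.
(* Group by cardinality; [inord] is faithful here because [U \subset D] bounds [#|U|]. *)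
rewrite (partition_big (fun U : {set T} => inord #|U| : 'I_#|D|.+1) xpredT) //=.
apply: eq_bigr => u _.
rewrite -cards_draws -sum1dep_card natr_sum mulr_suml.
apply: eq_big => U.
  by apply: andb_id2l => /subset_leq_card UD; rewrite -val_eqE /= inordK.
by case/andP => /subset_leq_card UD /eqP <-; rewrite inordK // mul1r.
Qed.

(** * Permanent of a scaled partial matching plus a constant matrix *)

Lemma permanent_partial_perm (R : comNzRingType) (m : nat) (D : {set 'I_m})
    (f : 'I_m -> 'I_m) (s t : R) :
  {in D &, injective f} ->
  permanent (\matrix_(i, j) (s *+ ((i \in D) && (j == f i)) + t)) =
  \sum_(u < #|D|.+1) ('C(#|D|, u) * (m - u)`!)%:R * s ^+ u * t ^+ (m - u).
Proof.
move=> f_inj; rewrite /permanent.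
under eq_bigr => p _.
  under eq_bigr => i _ do rewrite mxE.
  rewrite bigA_distr.
  under eq_bigr => U _.
    rewrite (_ : \prod_i _ = (s ^+ #|U| * t ^+ (m - #|U|)) *+
       ((U \subset D) && [forall i in U, p i == f i])); last first.
      rewrite big_if /= prodr_const.
      have -> : #|[pred i | i \notin U]| = (m - #|U|)%N.
        have <- : #|~: U| = (m - #|U|)%N by rewrite cardsCs finset.setCK card_ord.
        by apply: eq_card => i; rewrite !inE.
      case: andP => [[UD /forall_inP pE]|nUD].
        rewrite (eq_bigr (fun=> s)) ?prodr_const // => i iU.
        by rewrite (fintype.subsetP UD) //= pE.
      (* Some row of [U] misses the matching, so its factor is [s *+ 0] and the product vanishes. *)
      have [i iU iN] : exists2 i, i \in U & ~~ ((i \in D) && (p i == f i)).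
        apply/exists_inP; apply: contraT; rewrite negb_exists_in.
        move=> /forall_inP H; case: nUD; split.
          by apply/fintype.subsetP => i /H; rewrite negbK => /andP[].
        by apply/forall_inP => i /H; rewrite negbK => /andP[].
      by rewrite (bigD1 i) //= (negPf iN) mulr0n !mul0r.
    over.
  over.
(* Summing over [p] first turns the inner sum, for fixed [U], into a count of permutations. *)
rewrite exchange_big /= (bigID (fun U : {set 'I_m} => U \subset D)) /=.
rewrite [X in _ + X]big1 ?addr0; last first.
  by move=> U /negPf UD; rewrite big1 // => p _; rewrite UD.
transitivity (\sum_(U : {set 'I_m} | U \subset D)
   (((m - #|U|)`!)%:R * (s ^+ #|U| * t ^+ (m - #|U|)))).
  apply: eq_bigr => U UD; under eq_bigr => p _ do rewrite UD /= -mulr_natl.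
  rewrite -mulr_suml -natr_sum; congr (_%:R * _).
  have fU_inj : {in U &, injective f}.
    by move=> i j iU jU; apply: f_inj; apply: (fintype.subsetP UD).
  have := card_perm_extend fU_inj; rewrite card_ord => <-.
  by rewrite -sum1dep_card [RHS]big_mkcond.
rewrite (sum_subset_card _ (fun u => (m - u)`!%:R * (s ^+ u * t ^+ (m - u)))).
by apply: eq_bigr => u _; rewrite natrM !mulrA.
Qed.

(** * Submatrices indexed by subsets and the Johnson distance *)

Lemma lsub_elt_inj (n l : nat) (S : lsubset n l) : injective (lsub_elt S).
Proof. by move=> i j /enum_val_inj /cast_ord_inj. Qed.

Lemma lsub_eltP (n l : nat) (S : lsubset n l) x :
  reflect (exists i, lsub_elt S i = x) (x \in val S).
Proof.
apply: (iffP idP) => [xS|[i <-]]; last exact: enum_valP.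
exists (cast_ord (eqP (valP S)) (enum_rank_in xS x)).
by rewrite /lsub_elt cast_ordK enum_rankK_in.
Qed.

(** [S :\: T] lies both in [S] and in the complement of [T]; hence the range of [k] in the
    expansion. *)
Lemma johnson_dist_le (n l : nat) (S T : lsubset n l) :
  (johnson_dist S T <= minn l (n - l))%N.
Proof.
have <- : #|~: val T| = (n - l)%N.
  by rewrite cardsCs finset.setCK card_ord (eqP (valP T)).
rewrite leq_min; apply/andP; split.
  by apply: leq_trans (eq_leq (eqP (valP S))); rewrite subset_leq_card ?finset.subsetDl.
by rewrite subset_leq_card // /johnson_dist finset.setDE finset.subsetIr.
Qed.

Lemma permanent_johnson (R : comNzRingType) (n l : nat) (s t : R)
    (S T : lsubset n l) (k := johnson_dist S T) :
  permanent (mxsub (lsub_elt S) (lsub_elt T)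
    (s *: (1%:M : 'M[R]_n) + t *: (const_mx 1 : 'M[R]_n))) =
  \sum_(u < (l - k).+1) ('C(l - k, u) * (l - u)`!)%:R * s ^+ u * t ^+ (l - u).
Proof.
pose D := [set i | lsub_elt S i \in val T].
(* [f i] is the position in [T] of the [i]-th element of [S]; the default [i] arises only outside
   [D], where the entry is just [t]. *)
pose f i := odflt i [pick j | lsub_elt T j == lsub_elt S i].
have fE i : i \in D -> lsub_elt T (f i) = lsub_elt S i.
  rewrite inE => /lsub_eltP[j jE]; rewrite /f; case: pickP => [? /eqP//|/(_ j)].
  by rewrite jE eqxx.
have f_inj : {in D &, injective f}.
  move=> i j iD jD fij; apply: (@lsub_elt_inj _ _ S).
  by rewrite -!fE // fij.
(* [lsub_elt S] maps [D] bijectively onto [S :&: T], whose size is [l] minus that of [S :\: T]. *)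
have <- : #|D| = (l - k)%N.
  have <- : (#|val S| - k = l - k)%N by rewrite (eqP (valP S)).
  rewrite -(card_imset _ (@lsub_elt_inj _ _ S)) /k /johnson_dist.
  rewrite cardsD subKn ?subset_leq_card ?finset.subsetIl //; apply: eq_card => x.
  rewrite inE; apply/imsetP/andP => [[i iD ->]|[/lsub_eltP[i <-] iT]].
    by split; [apply/lsub_eltP; exists i | rewrite inE in iD].
  by exists i; rewrite ?inE.
rewrite -(permanent_partial_perm s t f_inj); congr permanent.
apply/matrixP => i j; rewrite !mxE mulr1 mulr_natr; congr (s *+ _ + t).
case: (boolP (i \in D)) => /= [iD|].
  by rewrite -(fE _ iD) eq_sym (inj_eq (@lsub_elt_inj _ _ T)).
rewrite inE => iT; apply/eqP; rewrite eqb0.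
by apply: contraNneq iT => ->; apply/lsub_eltP; exists j.
Qed.

(** * Expansion in the Johnson matrices *)

(** Two subsets are at exactly one distance, and it is in range, so a single term survives. *)
Lemma sum_JS_entry (R : comNzRingType) (n l : nat) (c : nat -> R) i j :
  (\sum_(k < (minn l (n - l)).+1) c k *: JS R n l k) i j =
  c (johnson_dist (lsub i) (lsub j)).
Proof.
set d := johnson_dist _ _; have dP : (d < (minn l (n - l)).+1)%N by apply: johnson_dist_le.
rewrite summxE (bigD1 (Ordinal dP)) //= big1 ?addr0 => [|k kd].
  by rewrite !mxE eqxx mulr1.
by rewrite !mxE -/d -[d == k]/(Ordinal dP == k :> nat) val_eqE eq_sym (negPf kd) mulr0.
Qed.

Lemma exp_momentE (R : comNzRingType) (l k : nat) (s t : R) : (k <= l)%N ->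
  exp_moment (l - k) k s t =
  \sum_(k <= j < l.+1) ('C(l - k, l - j) * j`!)%:R * s ^+ (l - j) * t ^+ j.
Proof.
move=> kl; rewrite -[X in index_iota X _]add0n big_addn subSn // big_mkord.
apply: eq_bigr => i _; have il : (i <= l - k)%N by rewrite -ltnS.
(* With [j = k + i], the binomials agree by the symmetry exchanging [i] and [l - k - i]. *)
by rewrite [(i + k)%N]addnC subnDA bin_sub.
Qed.

Lemma perm_compound_sI_tJ (R : comNzRingType) (n l : nat) (s t : R) :
  perm_compound l (s *: (1%:M : 'M[R]_n) + t *: (const_mx 1 : 'M[R]_n)) =
  \sum_(k < (minn l (n - l)).+1) exp_moment (l - k) k s t *: JS R n l k.
Proof.
apply/matrixP => i j.
rewrite (@sum_JS_entry _ _ _ (fun k => exp_moment (l - k) k s t)) mxE permanent_johnson.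
set k := johnson_dist _ _.
have kl : (k <= l)%N.
  by have := johnson_dist_le (lsub i) (lsub j); rewrite leq_min => /andP[].
(* [u] counts the choices of [s], while [exp_moment] is indexed by the power of [t] beyond [k];
   reversal matches [u] with [l - k - u]. *)
rewrite [RHS](reindex_inj rev_ord_inj) /exp_moment; apply: eq_bigr => u _.
have ul : (u <= l - k)%N by rewrite -ltnS.
by rewrite /= subSS subKn // bin_sub // addnBA // subnKC.
Qed.

(** * The integral form of the exponential moments *)

(* An antiderivative of [y ^+ n * expR (- y)], by repeated integration by parts. *)
Fixpoint expM_primitive (R : realType) (n : nat) (y : R) : R :=
  if n is m.+1 then
    n%:R * expM_primitive m y - y ^+ n * expR (- y)
  else - expR (- y).

Lemma is_derive_expM_primitive (R : realType) (n : nat) (y : R) :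
  is_derive y 1 (@expM_primitive R n) (y ^+ n * expR (- y)).
Proof.
elim: n => [|n IH] /=.
  by apply: is_derive_eq; rewrite expr0; ring.
have := is_deriveX n.+1 (is_derive_id y (1 : R)); rewrite exprfctE => dX.
have dE : is_derive y 1 (fun y : R => expR (- y)) (- expR (- y)).
  by apply: is_derive_eq; ring.
have D : is_derive y 1 (fun z => n.+1%:R * expM_primitive n z - z ^+ n.+1 * expR (- z)) _ :=
  is_deriveB (is_deriveZ n.+1%:R IH) (is_deriveM dX dE).
apply: is_derive_eq.
by rewrite /GRing.scale /=; ring.
Qed.

Lemma expM_primitive0 (R : realType) (n : nat) :
  expM_primitive n (0 : R) = - n`!%:R.
Proof.
elim: n => [|n IH] /=; first by rewrite oppr0 expR0.
by rewrite IH expr0n mul0r subr0 factS natrM mulrN.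
Qed.

(** The term of degree [n.+1] in the exponential series gives [y ^+ n.+1 / n.+1! <= expR y], so the
    expression is at most [n.+1! / y] for positive [y]. *)
Lemma cvg_expM (R : realType) (n : nat) :
  ((y ^+ n * expR (- y) : R) @[y --> +oo%R] --> (0 : R))%classic.
Proof.
apply/cvgrPdist_le => e e0; near=> y.
have y0 : 0 < y by near: y; apply: nbhs_pinfty_gt; exact: num_real.
have yn0 k : 0 <= y ^+ k by rewrite exprn_ge0 // ltW.
rewrite sub0r normrN ger0_norm ?mulr_ge0 ?expR_ge0 //.
have ye : n.+1`!%:R / e <= y.
  by near: y; apply: nbhs_pinfty_ge; exact: num_real.
rewrite expRN ler_pdivrMr ?expR_gt0 //.
apply: (@le_trans _ _ (e * (y ^+ n.+1 / n.+1`!%:R))).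
  rewrite mulrA ler_pdivlMr ?ltr0n ?fact_gt0 // exprS mulrA mulrC.
  by rewrite ler_wpM2r // mulrC -ler_pdivrMr.
rewrite ler_pM2l //; apply: le_trans (expR_ge1Dxn n (ltW y0)).
by rewrite lerDr.
Unshelve. all: by end_near. Qed.

Lemma cvg_expM_primitive (R : realType) (n : nat) :
  ((@expM_primitive R n y) @[y --> +oo%R] --> (0 : R))%classic.
Proof.
elim: n => [|n IH] /=.
  by rewrite -oppr0; apply: cvgN; exact: cvgr_expR.
rewrite -(subr0 0) -{1}(mulr0 n.+1%:R).
by apply: cvgB; [apply: cvgMl_tmp | apply: cvg_expM].
Qed.

Lemma continuous_expM (R : realType) (n : nat) :
  continuous (fun y : R => y ^+ n * expR (- y)).
Proof.
move=> y; apply: cvgM; first exact: exprn_continuous.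
apply: continuous_comp; [exact: oppr_continuous | exact: continuous_expR].
Qed.

Lemma integral_expM (R : realType) (n : nat) :
  (\int[lebesgue_measure]_(y in `[0%R, +oo[) (y ^+ n * expR (- y))%:E =
   (n`!%:R : R)%:E)%E.
Proof.
(* The primitive tends to 0 at infinity and equals [- n!] at 0. *)
rewrite (ge0_continuous_FTC2y (F := @expM_primitive R n) (l := 0)).
- by rewrite expM_primitive0 -EFinB sub0r opprK.
- by move=> y y0; rewrite mulr_ge0 ?exprn_ge0 ?expR_ge0.
- exact/continuous_subspaceT/continuous_expM.
- exact: cvg_expM_primitive.
- by move=> y _; have [] := is_derive_expM_primitive n y.
- apply: cvg_at_right_filter; apply: differentiable_continuous.
  by apply/derivable1_diffP; have [] := is_derive_expM_primitive n (0 : R).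
- by move=> y _; rewrite derive1E; have [_ ->] := is_derive_expM_primitive n y.
Qed.

Lemma integrable_expM (R : realType) (n : nat) :
  (@lebesgue_measure R).-integrable `[0, +oo[%classic
    (EFin \o (fun y : R => y ^+ n * expR (- y))).
Proof.
have mE : measurable_fun (`[0, +oo[%classic : set R)
    (fun y : R => y ^+ n * expR (- y)).
  by apply: measurable_funTS; apply: continuous_measurable_fun; exact: continuous_expM.
apply/integrableP; split; first exact/measurable_EFinP.
(* Finiteness of the computed value yields absolute integrability. *)
have := integral_fin_num_abs lebesgue_measure (measurable_itv _) mE.
by rewrite integral_expM; apply.
Qed.

Lemma Rintegral_sum d (T : measurableType d) (R : realType)
    (mu : {measure set T -> \bar R}) (D : set T) (n : nat) (f : nat -> T -> R) :
  measurable D -> (forall i, mu.-integrable D (EFin \o f i)) ->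
  Rintegral mu D (fun x => \sum_(i < n) f i x) =
  \sum_(i < n) Rintegral mu D (f i).
Proof.
move=> mD fint; elim: n => [|n IH].
  under eq_Rintegral do rewrite big_ord0.
  by rewrite big_ord0 Rintegral_cst // mul0r.
under eq_Rintegral do rewrite big_ord_recr.
rewrite big_ord_recr /= RintegralD ?IH //.
have := integrable_sum mD (index_enum 'I_n) (P := xpredT) (fun i _ => fint i).
by apply: eq_integrable => // x _ /=; rewrite sumEFin.
Qed.

Lemma exp_moment_intE (R : realType) (a b : nat) (x t : R) :
  exp_moment_int a b x t = exp_moment a b x t.
Proof.
(* By the binomial theorem, [c j] is the coefficient of [y ^+ (b + j)] in the polynomial factor;
   integrating termwise multiplies it by [(b + j)!]. *)
pose c j := 'C(a, j)%:R * x ^+ (a - j) * t ^+ (b + j).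
pose f j (y : R) := c j * (y ^+ (b + j) * expR (- y)).
transitivity (Rintegral (@lebesgue_measure R) `[0, +oo[%classic
    (fun y => \sum_(j < a.+1) f j y)).
  apply: eq_Rintegral => y _; rewrite exprDn !mulr_suml; apply: eq_bigr => j _.
  by rewrite /f /c -mulr_natl !exprMn !exprD; ring.
rewrite Rintegral_sum // => [|j].
  apply: eq_bigr => j _; rewrite RintegralZl //; last exact: integrable_expM.
  by rewrite /Rintegral integral_expM /= /c natrM; ring.
have := integrableZl _ (c j) (integrable_expM R (b + j)).
by apply; exact: measurable_itv.
Qed.

Theorem theorem4p1 (n l : nat) (hl : (1 <= l <= n)%N) :
  (forall (R : comNzRingType) (s t : R),
    perm_compound l (s *: (1%:M : 'M[R]_n) + t *: (const_mx 1 : 'M[R]_n)) =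
      \sum_(k < (minn l (n - l)).+1)
        (\sum_(k <= j < l.+1)
           ('C(l - k, l - j) * j`!)%:R * s ^+ (l - j) * t ^+ j) *: JS R n l k
    /\
    perm_compound l (s *: (1%:M : 'M[R]_n) + t *: (const_mx 1 : 'M[R]_n)) =
      \sum_(k < (minn l (n - l)).+1)
        exp_moment (l - k) k s t *: JS R n l k)
  /\
  (forall (R : realType) (s t : R),
    perm_compound l (s *: (1%:M : 'M[R]_n) + t *: (const_mx 1 : 'M[R]_n)) =
      \sum_(k < (minn l (n - l)).+1)
        exp_moment_int (l - k) k s t *: JS R n l k).
Proof.
split=> R s t.
  rewrite !perm_compound_sI_tJ; split=> //; apply: eq_bigr => k _.
  (* The range of [k] supplies the bound [k <= l] under which the two coefficient sums agree. *)
  rewrite exp_momentE //; apply: leq_trans (geq_minl l (n - l)).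
  by rewrite -ltnS.
by rewrite perm_compound_sI_tJ; apply: eq_bigr => k _; rewrite exp_moment_intE.
Qed.
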